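(* Let $\mathcal{H}=\mathbb{R}^n$ and consider a centered additive noise model $Y=X+Z$, i.e. $p_{Y|X}(y|x)=p_Z(y-x)$ for $x,y\in\mathcal{H}$, where $p_Z$ is the probability density of a random variable $Z\in\mathcal{H}$ with mean zero. Assume that $p_Z(z)>0$ for any $z\in\mathcal{H}$ and denote $F(z):=-\log p_Z(z)$. If $F$ is continuous and $p_{Y|X}$ is of the form $$p_{Y|X}(y|x)=\exp\left(c\langle x,y\rangle-a(x)-b(y)\right),\qquad\forall x,y\in\mathcal{H},$$ for some $c\ge0$ and some functions $a,b:\mathcal{H}\to\mathbb{R}$, then $p_{Y|X}(y|x)$ is in fact Gaussian: there are $\sigma>0$ and a constant $C>0$ such that $$p_{Y|X}(y|x)=C\exp\left(-\frac{\|y-x\|^2}{2\sigma^2}\right),\qquad\forall x,y\in\mathcal{H}.$$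
   Context: $\langle\cdot,\cdot\rangle$ and $\|\cdot\|$ are the Euclidean inner product and norm on $\mathbb{R}^n$; densities are with respect to Lebesgue measure. ''Centered'' means that the noise $Z$ has zero mean. *)

(* Defs.v *)
From HB Require Import structures.
From mathcomp Require Import all_boot all_order all_algebra.
From mathcomp Require Import all_classical all_reals all_analysis.

Set Implicit Arguments.
Unset Strict Implicit.
Unset Printing Implicit Defensive.

Import Order.TTheory GRing.Theory Num.Theory.
Import numFieldNormedType.Exports.

Local Open Scope classical_set_scope.
Local Open Scope ring_scope.

Section euclidean.
Context {R : realType} {n : nat}.

Definition inner (x y : 'rV[R]_n) : R := \sum_(i < n) x ord0 i * y ord0 i.

(* The library's `|x| on 'rV[R]_n is the sup norm; it induces the same
   topology as enorm. *)
Definition enorm (x : 'rV[R]_n) : R := Num.sqrt (inner x x).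

End euclidean.

(* The sigma-algebra on R^n is the product of the Borel sigma-algebras of the
   coordinates, i.e. the Borel sigma-algebra of R^n. *)
Definition measure_rV_display : measure_display -> measure_display.
Proof. exact. Qed.

Section measurable_rV.
Context {R : realType} {n : nat}.

Let coor (i : 'I_n) (v : 'rV[R]_n) : R := v ord0 i.

Let rV_set0 : g_sigma_preimage coor set0.
Proof. exact: sigma_algebra0. Qed.

Let rV_setC A : g_sigma_preimage coor A -> g_sigma_preimage coor (~` A).
Proof. exact: sigma_algebraC. Qed.

Let rV_bigcup (F : _^nat) : (forall i, g_sigma_preimage coor (F i)) ->
  g_sigma_preimage coor (\bigcup_i (F i)).
Proof. exact: sigma_algebra_bigcup. Qed.

HB.instance Definition _ := @isMeasurable.Build (measure_rV_display default_measure_display)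
  'rV[R]_n (g_sigma_preimage coor) rV_set0 rV_setC rV_bigcup.

Lemma measurable_coord (i : 'I_n) :
  measurable_fun [set: 'rV[R]_n] (fun v : 'rV[R]_n => v ord0 i).
Proof.
move=> _ Y mY; rewrite setTI; apply: sub_sigma_algebra => /=.
rewrite -bigcup_seq/=; exists i => /=; first by rewrite mem_index_enum.
by exists Y => //; rewrite setTI.
Qed.

Lemma measurable_fun_coordP d (T : measurableType d) (f : T -> 'rV[R]_n) :
  (forall i, measurable_fun [set: T] (fun x => f x ord0 i)) ->
  measurable_fun [set: T] f.
Proof.
move=> mf _ A mA; rewrite setTI.
suff : g_sigma_preimage (fun i => coor i \o f) `<=` measurable.
  apply; rewrite g_sigma_preimage_comp.
  by exists A => //; rewrite setTI.
apply: smallest_sub; first exact: sigma_algebra_measurable.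
rewrite -bigcup_seq/=; apply: bigcup_sub => i _.
by move=> B [C mC <-]; exact: mf.
Qed.

End measurable_rV.

Section lebesgue_rVS.
Context {R : realType} {n : nat}.

Definition rV_cons (p : measurableTypeR R * 'rV[R]_n) : 'rV[R]_n.+1 :=
  row_mx (const_mx p.1 : 'rV[R]_1) p.2.

Lemma rV_cons0 p : rV_cons p ord0 ord0 = p.1.
Proof.
have -> : ord0 = lshift n (ord0 : 'I_1) :> 'I_n.+1 by exact/val_inj.
by apply: etrans (row_mxEl (const_mx p.1) p.2 _ _) _; rewrite mxE.
Qed.

Lemma rV_consS p i : rV_cons p ord0 (lift ord0 i) = p.2 ord0 i.
Proof.
have -> : lift ord0 i = rshift 1 i :> 'I_n.+1 by exact/val_inj.
exact: (row_mxEr (const_mx p.1)).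
Qed.

Lemma measurable_rV_cons : measurable_fun [set: measurableTypeR R * 'rV[R]_n] rV_cons.
Proof.
apply: measurable_fun_coordP => i; case: (unliftP ord0 i) => [j|] ->.
- under eq_fun do rewrite rV_consS.
  exact: measurableT_comp (measurable_coord j) measurable_snd.
- under eq_fun do rewrite rV_cons0.
  exact: measurable_fst.
Qed.

Definition rV_uncons (v : 'rV[R]_n.+1) : measurableTypeR R * 'rV[R]_n :=
  (v ord0 ord0, \row_i v ord0 (lift ord0 i)).

Lemma rV_consK : cancel rV_cons rV_uncons.
Proof.
move=> p; rewrite /rV_uncons rV_cons0 [RHS]surjective_pairing; congr pair.
by apply/rowP => i; rewrite mxE rV_consS.
Qed.

Lemma measurable_rV_uncons : measurable_fun [set: 'rV[R]_n.+1] rV_uncons.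
Proof.
apply/measurable_fun_pairP; split; first exact: measurable_coord.
apply: measurable_fun_coordP => i.
rewrite (_ : (fun _ => _) = fun v : 'rV[R]_n.+1 => v ord0 (lift ord0 i)).
  exact: measurable_coord.
by apply/funext => v; rewrite /= mxE.
Qed.

Variable m : {sigma_finite_measure set 'rV[R]_n -> \bar R}.

Definition lebesgue_rVS : set 'rV[R]_n.+1 -> \bar R :=
  pushforward (@lebesgue_measure R \x m)%E rV_cons.

Let mu : {measure set 'rV[R]_n.+1 -> \bar R} :=
  measure_function_pushforward__canonical__measure_function_Measure
    (@lebesgue_measure R \x m)%E measurable_rV_cons.

HB.instance Definition _ := isMeasure.Build _ _ _ lebesgue_rVS
  (@measure0 _ _ _ mu) (@measure_ge0 _ _ _ mu)
  (@measure_semi_sigma_additive _ _ _ mu).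

Let lebesgue_rVS_sigma_finite : sigma_finite setT lebesgue_rVS.
Proof.
have [F FT mF] : sigma_finite setT (@lebesgue_measure R \x m)%E.
  have /sigma_finiteP[F [TF ndF Foo]] := sigma_finiteT (@lebesgue_measure R).
  have /sigma_finiteP[G [TG ndG Goo]] := sigma_finiteT m.
  exists (fun k => F k `*` G k) => [|k].
    rewrite -setXTT TF TG predeqE => -[x y]; split; last first.
      by move=> [k _ []/= ? ?]; split; exists k.
    move=> [/= [i _ Fx] [j _ Gy]]; exists (maxn i j) => //; split.
    - by move: x Fx; exact/subsetPset/ndF/leq_maxl.
    - by move: y Gy; exact/subsetPset/ndG/leq_maxr.
  have [? ?] := Foo k; have [? ?] := Goo k; split; first exact: measurableX.
  by rewrite product_measure1E// lte_mul_pinfty// ge0_fin_numE.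
exists (fun k => rV_uncons @^-1` F k).
  by rewrite -preimage_bigcup -FT preimage_setT.
move=> k; have [mFk Fk] := mF k; split.
  by rewrite -[X in measurable X]setTI; exact: measurable_rV_uncons.
rewrite /lebesgue_rVS /pushforward -comp_preimage.
by rewrite (_ : rV_uncons \o rV_cons = id)//; apply/funext => p; exact: rV_consK.
Qed.

HB.instance Definition _ :=
  Measure_isSigmaFinite.Build _ _ _ lebesgue_rVS lebesgue_rVS_sigma_finite.

End lebesgue_rVS.

(* Lebesgue measure on R^n; for n = 0 it is the unit mass at the single point. *)
Fixpoint lebesgue_rV {R : realType} (n : nat) :
    {sigma_finite_measure set 'rV[R]_n -> \bar R} :=
  match n with
  | 0 => \d_(0 : 'rV[R]_0)
  | n'.+1 => lebesgue_rVS (lebesgue_rV n')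
  end.

Lemma lebesgue_rV_box {R : realType} n (A : 'I_n -> set R) :
  (forall i, measurable (A i)) ->
  lebesgue_rV n [set v | forall i, A i (v ord0 i)]
  = (\prod_(i < n) lebesgue_measure (A i))%E.
Proof.
elim: n A => [A _|n IH A mA].
  rewrite big_ord0 /= diracE mem_set//; by case.
have mS : measurable [set v : 'rV[R]_n | forall i, A (lift ord0 i) (v ord0 i)].
  rewrite (_ : mkset _ = \bigcap_(i in setT)
      ((fun v : 'rV[R]_n => v ord0 i) @^-1` A (lift ord0 i))); last first.
    by apply/seteqP; split => v Av i *; exact: Av.
  apply: fin_bigcap_measurable => // i _.
  by rewrite -[X in measurable X]setTI; exact: measurable_coord.
rewrite big_ord_recl -(IH (fun i => A (lift ord0 i)))// -product_measure1E//; last exact: mA.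
rewrite /= /lebesgue_rVS /pushforward; congr (_ _).
apply/seteqP; split => [p Ap|p [A0 AS] i] /=.
  split; first by rewrite -rV_cons0; exact: Ap.
  by move=> i; rewrite -rV_consS; exact: Ap.
by case: (unliftP ord0 i) => [j|] ->; rewrite ?rV_cons0 ?rV_consS.
Qed.

Section density.
Context {R : realType} {n : nat} {d : measure_display} {Omega : measurableType d}.
Variables (P : probability Omega R) (Z : {RV P >-> 'rV[R]_n}).

Definition has_density (p : 'rV[R]_n -> R) : Prop :=
  [/\ measurable_fun [set: 'rV[R]_n] p,
      forall z, 0 <= p z &
      forall A, measurable A ->
        distribution P Z A = (\int[lebesgue_rV n]_(z in A) (p z)%:E)%E].

Definition zero_mean : Prop :=
  forall i : 'I_n,
    P.-integrable [set: Omega] (fun w => (Z w ord0 i)%:E) /\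
    ('E_P[fun w => Z w ord0 i] = 0)%E.

End density.

(* Main.v *)
Require Import Defs.
From mathcomp Require Import all_boot all_order all_algebra.
From mathcomp Require Import all_classical all_reals all_analysis.
From mathcomp Require Import measurable_realfun ring lra.

Import Order.TTheory GRing.Theory Num.Theory.
Import numFieldNormedType.Exports.

Local Open Scope classical_set_scope.
Local Open Scope ring_scope.

(* Expanding |y - x|^2, the function G z := F z - F 0 - c / 2 * |z|^2 is additive,
   hence linear by continuity, so p_Z z is exp (k - <u, z> - c / 2 * |z|^2).
   If c = 0 and n > 0, then p_Z z + p_Z (- z) is bounded below by a positive
   constant and has infinite integral. If c > 0, then p_Z is symmetric about
   - u / c, which must be the mean, so u = 0. *)

(** * Cauchy's functional equation on the line *)

(** Additivity settles integer multiples, then rationals by clearing denominators; continuity and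
    the density of the rationals do the rest. *)
Lemma continuous_additive_linear (R : realType) (h : R -> R) :
  {morph h : x y / x + y} -> continuous h -> forall x, h x = x * h 1.
Proof.
move=> hD hc.
have h0 : h 0 = 0.
  by apply: (addrI (h 0)); rewrite -hD !addr0.
have hN x : h (- x) = - h x.
  by apply: (addrI (h x)); rewrite -hD !subrr.
have hMn x n : h (x *+ n) = h x *+ n.
  by elim: n => [|n IH]; rewrite ?mulr0n// !mulrS hD IH.
have hZ (m : int) x : h (x * m%:~R) = h x * m%:~R.
  rewrite !mulrzr; case: m => m; first by rewrite -!pmulrn hMn.
  by rewrite NegzE !mulrNz hN -!pmulrn hMn.
have hQ (q : rat) : h (ratr q) = ratr q * h 1.
  have dq : (denq q)%:~R != 0 :> R by rewrite intr_eq0 denq_neq0.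
  apply: (mulIf dq); rewrite -hZ /ratr divfK// mulrAC divfK//.
  by rewrite -[in LHS](mul1r (numq q)%:~R) hZ mulrC.
move=> x; apply/eqP; rewrite -subr_eq0; apply/eqP.
pose g y := h y - y * h 1.
have gc : continuous g.
  move=> y; apply: cvgB; first exact: hc.
  by apply: cvgM; [exact: cvg_id|exact: cvg_cst].
(* Otherwise the open set where [g] is nonzero would contain a rational, and [g] vanishes at
   rationals. *)
apply: contrapT => /eqP gx.
have oS : open (g @^-1` [set~ 0]).
  apply: open_comp; first by move=> y _; exact: gc.
  exact/closed_openC/closed_eq.
have [|y [gy [q _ qy]]] := @dense_rat R (g @^-1` [set~ 0]) _ oS.
  by exists x; apply/eqP.
by apply: gy; rewrite /g -qy hQ subrr.
Qed.

(** * Bilinear algebra and the quadratic shape of [F] *)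

Section inner.
Context {R : realType} {n : nat}.
Implicit Types x y z : 'rV[R]_n.

Lemma innerC x y : inner x y = inner y x.
Proof. by apply: eq_bigr => i _; rewrite mulrC. Qed.

Lemma innerDr x y z : inner x (y + z) = inner x y + inner x z.
Proof.
by rewrite -big_split; apply: eq_bigr => i _; rewrite mxE mulrDr.
Qed.

Lemma innerNr x y : inner x (- y) = - inner x y.
Proof. by rewrite -sumrN; apply: eq_bigr => i _; rewrite mxE mulrN. Qed.

Lemma innerZr a x y : inner x (a *: y) = a * inner x y.
Proof.
by rewrite mulr_sumr; apply: eq_bigr => i _; rewrite mxE mulrCA.
Qed.

Lemma inner0r x : inner x 0 = 0.
Proof. by rewrite -[0](scale0r 0) innerZr mul0r. Qed.

Lemma innerDl x y z : inner (x + y) z = inner x z + inner y z.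
Proof. by rewrite innerC innerDr !(innerC z). Qed.

Lemma innerNl x y : inner (- x) y = - inner x y.
Proof. by rewrite innerC innerNr innerC. Qed.

Lemma innerZl a x y : inner (a *: x) y = a * inner x y.
Proof. by rewrite innerC innerZr innerC. Qed.

Lemma enorm_sqr x : enorm x ^+ 2 = inner x x.
Proof. by rewrite sqr_sqrtr// sumr_ge0// => i _; rewrite -expr2 sqr_ge0. Qed.

(** For [F = - ln pZ], the second hypothesis is the logarithm of the assumed exponential form. *)
Lemma continuous_difference_bilinear (F a b : 'rV[R]_n -> R) (c : R) :
  continuous F ->
  (forall x y, F (y - x) = a x + b y - c * inner x y) ->
  exists u, forall z, F z = F 0 + inner u z + c / 2 * inner z z.
Proof.
move=> Fc FE.
pose G z := F z - F 0 - c / 2 * inner z z.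
have GD : {morph G : x y / x + y}.
  move=> x y; rewrite /G innerDl !innerDr (innerC y x).
  (* These four instances eliminate [a] and [b]: [F (x + y) - F x - F y + F 0 = c * inner x y], the
     polarization of [c / 2 * inner z z]. *)
  have := FE (- x) y; have := FE 0 y; have := FE (- x) 0; have := FE 0 0.
  rewrite !opprK !subr0 add0r (addrC y) !innerNl (innerC 0 y) !inner0r.
  by move=> -> -> -> ->; field.
have G0 : G 0 = 0 by rewrite /G inner0r; ring.
pose e i : 'rV[R]_n := delta_mx ord0 i.
have Glin i r : G (r *: e i) = r * G (e i).
  (* Along each coordinate axis [G] is a continuous additive function of one real variable. *)
  rewrite (@continuous_additive_linear _ (fun r => G (r *: e i))) ?scale1r//.
    by move=> x y; rewrite scalerDl GD.
  move=> s.
  under eq_fun do rewrite /G innerZl innerZr.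
  apply: cvgB; last first.
    apply: cvgM; first exact: cvg_cst.
    by do 2 (apply: cvgM; [exact: cvg_id|]); exact: cvg_cst.
  apply: cvgB; last exact: cvg_cst.
  apply: (@continuous_comp _ _ _ (fun t : R => t *: e i) F); last exact: Fc.
  by apply: cvgZr_tmp; exact: cvg_id.
exists (\row_i G (e i)) => z.
suff : G z = inner (\row_i G (e i)) z by rewrite /G => <-; ring.
rewrite [in LHS](row_sum_delta z) (big_morph G GD G0).
by apply: eq_bigr => i _; rewrite Glin mxE mulrC.
Qed.

End inner.

(** * Point reflections and the total mass of Lebesgue measure *)

Section reflection.
Context {R : realType}.

Lemma lebesgue_measure_reflect (t : R) (A : set (measurableTypeR R)) :
  measurable A ->
  lebesgue_measure ((fun x : R => t - x) @^-1` A) = lebesgue_measure A.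
Proof.
move=> mA.
have mr : measurable_fun [set: measurableTypeR R]
    ((fun x => t - x) : measurableTypeR R -> measurableTypeR R).
  by apply: measurable_funB.
pose mu := measure_function_pushforward__canonical__measure_function_Measure
  (@lebesgue_measure R) mr.
apply/esym; apply: (@lebesgue_measure_unique R mu) => //.
move=> _ [[a b] _ <-].
rewrite /mu /= /pushforward.
(* Uniqueness is tested on intervals open on the left and closed on the right; reflection swaps the
   ends but keeps the length. *)
rewrite (_ : _ @^-1` _ = [set` `[t - b, t - a[]); last first.
  by apply/seteqP; split => x /=; rewrite !in_itv /=; lra.
rewrite !lebesgue_measure_itv /= !lte_fin ltrD2l ltrN2.
by case: ifP => // _; rewrite -!EFinD; congr (_%:E); ring.
Qed.

Lemma measurable_rV_reflect n (t : 'rV[R]_n) :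
  measurable_fun [set: 'rV[R]_n] (fun v => t - v).
Proof.
apply: measurable_fun_coordP => i.
rewrite (_ : (fun _ => _) = fun v : 'rV[R]_n => t ord0 i - v ord0 i).
  by apply: measurable_funB => //; exact: measurable_coord.
by apply/funext => v; rewrite !mxE.
Qed.

(** By induction on the dimension: the reflection acts separately on the first coordinate and the
    rest, so uniqueness of the product measure leaves only rectangles to check. *)
Lemma lebesgue_rV_reflect n (t : 'rV[R]_n) (A : set 'rV[R]_n) :
  measurable A ->
  lebesgue_rV n ((fun v => t - v) @^-1` A) = lebesgue_rV n A.
Proof.
elim: n t A => [t A _|n IH t A mA].
  by congr (_ _); apply/funext => v; congr A; apply/rowP; case.
pose m2 : {sigma_finite_measure set 'rV[R]_n -> \bar R} := lebesgue_rV n.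
pose r1 : measurableTypeR R -> measurableTypeR R := fun x => (rV_uncons t).1 - x.
pose r2 : 'rV[R]_n -> 'rV[R]_n := fun v => (rV_uncons t).2 - v.
pose r : measurableTypeR R * 'rV[R]_n -> measurableTypeR R * 'rV[R]_n :=
  fun q => (r1 q.1, r2 q.2).
have mr1 : measurable_fun setT r1 by apply: measurable_funB.
have mr2 : measurable_fun setT r2 by exact: measurable_rV_reflect.
have mr : measurable_fun setT r.
  apply/measurable_fun_pairP; split.
    exact: measurableT_comp mr1 measurable_fst.
  exact: measurableT_comp mr2 measurable_snd.
pose mu := measure_function_pushforward__canonical__measure_function_Measure
  (@lebesgue_measure R \x m2)%E mr.
(* [rV_cons] carries [r] to the reflection, moving the claim to the product space. *)
have rE q : t - rV_cons q = rV_cons (r q).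
  apply/rowP => i; rewrite mxE; case: (unliftP ord0 i) => [j|] ->.
    by rewrite mxE !rV_consS !mxE.
  by rewrite mxE !rV_cons0.
have mcA : measurable (rV_cons @^-1` A).
  by rewrite -[X in measurable X]setTI; exact: measurable_rV_cons.
transitivity (mu (rV_cons @^-1` A)).
  rewrite /mu /= /lebesgue_rVS /pushforward; congr (_ _).
  by apply/funext => q; rewrite /preimage /= rE.
apply/esym; apply: product_measure_unique => // B C mB mC.
rewrite /mu /= /pushforward.
have mB' : measurable (r1 @^-1` B) by rewrite -[X in measurable X]setTI; exact: mr1.
have mC' : measurable (r2 @^-1` C) by rewrite -[X in measurable X]setTI; exact: mr2.
transitivity ((@lebesgue_measure R \x m2)%E (r1 @^-1` B `*` r2 @^-1` C)).
  by [].
rewrite product_measure1E//; congr (_ * _)%E; last exact: IH.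
exact: lebesgue_measure_reflect.
Qed.

Lemma ge0_integral_rV_reflect n (t : 'rV[R]_n) (A : set 'rV[R]_n)
    (f : 'rV[R]_n -> \bar R) :
  measurable A -> measurable_fun A f -> (forall v, 0 <= f v)%E ->
  (\int[lebesgue_rV n]_(v in (fun v => t - v)%R @^-1` A) f (t - v)%R =
   \int[lebesgue_rV n]_(v in A) f v)%E.
Proof.
move=> mA mf f0.
rewrite -(ge0_integral_pushforward (measurable_rV_reflect n t))//.
apply: eq_measure_integral; first exact: measurable_rV_reflect.
by move=> mr B mB _; exact: lebesgue_rV_reflect.
Qed.

(** The space is a box whose sides have infinite length; for [n = 0] the empty product would give
    mass 1. *)
Lemma lebesgue_rVT n :
  (0 < n)%N -> lebesgue_rV n [set: 'rV[R]_n] = +oo%E.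
Proof.
case: n => // n _.
have -> : [set: 'rV[R]_n.+1] = [set v | forall i, [set: R] (v ord0 i)].
  by apply/seteqP; split.
rewrite (@lebesgue_rV_box _ _ (fun=> [set: R]))//.
have -> : lebesgue_measure [set: R] = +oo%E.
  by rewrite -set_itvNyy lebesgue_measure_itv.
by elim: n => [|n IH]; rewrite big_ord_recl ?big_ord0 ?mule1// IH mulyy.
Qed.

End reflection.

(** * Consequences of having a density *)

Section density.
Context {R : realType} {n : nat} {d : measure_display} {Omega : measurableType d}.
Variables (P : probability Omega R) (Z : {RV P >-> 'rV[R]_n}).
Variable p : 'rV[R]_n -> R.
Hypothesis Zp : has_density Z p.

Lemma integral_density : (\int[lebesgue_rV n]_z (p z)%:E = 1)%E.
Proof. by have [_ _ <-//] := Zp; exact: probability_setT. Qed.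

(** The symmetry gives [t - Z] the law of [Z], so the means agree: [t - 0 = 0]. Here [t] is twice
    the centre of symmetry. *)
Lemma symmetric_density_mean (t : 'rV[R]_n) :
  zero_mean Z -> (forall z, p (t - z) = p z) -> t = 0.
Proof.
move=> Z0 pt; have [mp p0 dE] := Zp.
apply/rowP => i; rewrite mxE; have [iZ EZ] := Z0 i.
have mc : measurable_fun [set: 'rV[R]_n] (fun v : 'rV[R]_n => (v ord0 i)%:E).
  by apply/measurable_EFinP; exact: measurable_coord.
have dt A : measurable A ->
    pushforward (distribution P Z) (fun v => t - v) A = distribution P Z A.
  move=> mA; rewrite dE// -(ge0_integral_rV_reflect n t)//; last first.
    exact/measurable_EFinP/measurable_funTS.
  under eq_integral do rewrite pt.
  rewrite /pushforward dE//.
  by rewrite -[X in measurable X]setTI; exact: measurable_rV_reflect.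
have it : P.-integrable setT (fun w => ((t - Z w) ord0 i)%:E).
  rewrite (_ : (fun _ => _) = fun w => ((t ord0 i)%:E - (Z w ord0 i)%:E)%E).
    by apply: integrableB => //; exact: finite_measure_integrable_cst.
  by apply/funext => w; rewrite !mxE.
have mW : measurable_fun setT (fun w => t - Z w).
  by apply: measurableT_comp (measurable_rV_reflect n t) _.
(* Both sides integrate the same coordinate function, against laws identified by [dt]. *)
have : (\int[P]_w ((t - Z w) ord0 i)%:E = \int[P]_w (Z w ord0 i)%:E)%E.
  rewrite -(integral_distribution mc iZ).
  rewrite -[LHS](@integral_pushforward _ _ _ _ _ _ mW P setT _ mc it measurableT).
  by apply: eq_measure_integral => // A mA _; exact: dt.
under eq_integral do rewrite !mxE EFinB.
rewrite integralB_EFin//; last exact: finite_measure_integrable_cst.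
move: EZ; rewrite unlock => ->.
rewrite integral_cst// [X in (_ * X)%E](_ : _ = 1%E) ?mule1; last exact: probability_setT.
by rewrite sube0 => -[].
Qed.

Lemma exp_affine_not_density (k : R) (u : 'rV[R]_n) : (0 < n)%N ->
  ~ (forall z, p z = expR (k + inner u z)).
Proof.
move=> n0 pE; have [mp p0 _] := Zp.
have mEp : measurable_fun [set: 'rV[R]_n] (fun z => (p z)%:E).
  exact/measurable_EFinP.
have mEpr : measurable_fun [set: 'rV[R]_n] (fun z => (p (0 - z))%:E).
  exact: measurableT_comp mEp (measurable_rV_reflect n 0).
(* Writing [0 - z] makes this a reflection with [t = 0], which preserves the integral. *)
have I2 : (\int[lebesgue_rV n]_z ((p z)%:E + (p (0 - z)%R)%:E) = 2%:E)%E.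
  have ip := integral_density.
  have ipr : (\int[lebesgue_rV n]_z (p (0 - z)%R)%:E = 1)%E.
    by rewrite -ip -[RHS](ge0_integral_rV_reflect n 0)//.
  by rewrite ge0_integralD ?ip ?ipr// => z _; rewrite lee_fin.
have : (\int[lebesgue_rV n]_z (2 * expR k)%:E <= 2%:E)%E.
  rewrite -I2; apply: ge0_le_integral => //.
    exact: emeasurable_funD.
  move=> z _; rewrite -EFinD lee_fin !pE add0r !expRD.
  rewrite innerNr; set s := inner u z.
  (* Adding [1 + s] and [1 - s] bounds [expR s + expR (- s)] below by 2. *)
  have := expR_ge1Dx s; have := expR_ge1Dx (- s); have := expR_gt0 k; nra.
rewrite integral_cst// [X in (_ * X)%E](_ : _ = +oo%E); last exact: lebesgue_rVT.
by rewrite gt0_muley// lte_fin mulr_gt0// expR_gt0.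
Qed.

End density.

Theorem proposition4 (R : realType) (n : nat)
  (d : measure_display) (Omega : measurableType d) (P : probability Omega R)
  (Z : {RV P >-> 'rV[R]_n}) (pZ : 'rV[R]_n -> R)
  (pYX : 'rV[R]_n -> 'rV[R]_n -> R) :
  has_density Z pZ ->
  zero_mean Z ->
  (* pYX y x stands for p_{Y|X}(y|x) *)
  (forall x y, pYX y x = pZ (y - x)) ->
  (forall z, 0 < pZ z) ->
  continuous (fun z => - ln (pZ z)) ->
  (exists (c : R) (a b : 'rV[R]_n -> R), 0 <= c /\
     forall x y, pYX y x = expR (c * inner x y - a x - b y)) ->
  exists sigma C : R, [/\ 0 < sigma, 0 < C &
    forall x y,
      pYX y x = C * expR (- (enorm (y - x) ^+ 2 / (2 * sigma ^+ 2)))].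
Proof.
move=> Zp Z0 pYXE pZ0 Fc [c [a [b [c0 abE]]]].
have [u FE] : exists u, forall z,
    - ln (pZ z) = - ln (pZ 0) + inner u z + c / 2 * inner z z.
  apply: (continuous_difference_bilinear _ a b) => // x y.
  by rewrite -pYXE abE expRK; ring.
have [k pE] : exists k, forall z, pZ z = expR (k - inner u z - c / 2 * inner z z).
  exists (ln (pZ 0)) => z; rewrite -[LHS]lnK ?posrE//; congr expR.
  by apply: oppr_inj; rewrite FE; ring.
(* In dimension 0 the density is constant and [c] may vanish, so [sigma] is simply taken to be 1. *)
have [n0|n0] := posnP n.
  have inner0 (v w : 'rV[R]_n) : inner v w = 0.
    by apply: big1 => -[m mn] _; exfalso; move: mn; rewrite n0.
  exists 1, (expR k); split; rewrite ?expR_gt0// => x y.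
  by rewrite pYXE enorm_sqr pE !inner0 mulr0 mul0r !subr0 oppr0 expR0 mulr1.
have cn0 : c != 0.
  apply/eqP => cE; apply: (exp_affine_not_density _ _ _ Zp k (- u) n0) => z.
  by rewrite pE cE innerNl; congr expR; ring.
have cp : 0 < c by rewrite lt_def cn0.
have u0 : u = 0.
  (* Completing the square puts the centre of symmetry at [- u / c]; the reflection vector is twice
     that. *)
  have : - (2 / c) *: u = 0.
    apply: (symmetric_density_mean _ _ _ Zp _ Z0) => z.
    rewrite !pE; congr expR.
    rewrite !(innerDr, innerDl, innerNr, innerNl, innerZr, innerZl) (innerC z u).
    by field.
  move/eqP; rewrite scaler_eq0 oppr_eq0 mulf_eq0 pnatr_eq0 invr_eq0 (negbTE cn0).
  by move/eqP.
(* Matching [c / 2] with [1 / (2 * sigma ^+ 2)] forces [sigma ^+ 2 = 1 / c]. *)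
exists (Num.sqrt c)^-1, (expR k); split; rewrite ?expR_gt0//.
  by rewrite invr_gt0 sqrtr_gt0.
move=> x y; rewrite pYXE pE u0 innerC inner0r subr0 expRD.
rewrite enorm_sqr exprVn sqr_sqrtr//; congr (_ * expR _).
by field.
Qed.
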